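(* Let $B \in \mathbb{R}^{n \times n}$ be a singular matrix of index 1, and let $m = \dim(\mathrm{range}(B)) < n$. Let $\Pi \in \mathbb{R}^{n \times m}$ have orthonormal columns which span $\mathrm{range}(B)$, and define $$\widehat{B} = \Pi^T B \Pi \in \mathbb{R}^{m \times m}.$$ Let $b \in \mathrm{range}(B)$, let $x_0 \in \mathbb{R}^n$, and let $x_k$ ($k = 0,1,2,\dots$) be the GMRES iterates for the system $Bx = b$ with starting vector $x_0$, with residuals $r_k = b - Bx_k$. Decompose $x_0 = x_0^1 + x_0^2$ with $x_0^1 \in \mathrm{range}(B)$ and $x_0^2 \in \mathrm{null}(B)$. Let $\widehat{x}_k$ be the GMRES iterates for the system $\widehat{B}\widehat{x} = \widehat{b}$ with $\widehat{b} = \Pi^T b$ and starting vector $\widehat{x}_0 = \Pi^T x_0^1$, with residuals $\widehat{r}_k = \widehat{b} - \widehat{B}\widehat{x}_k$. Then for all $k$ $$x_k = x_0^2 + \Pi \widehat{x}_k \quad \text{and} \quad r_k = b - Bx_k = \Pi(\widehat{b} - \widehat{B}\widehat{x}_k) = \Pi \widehat{r}_k.$$ In particular, if $\nu(\mathcal{F}(\widehat{B})) > 0$ and $r_0 \neq 0$, then for all $k$ $$\frac{\|r_k\|}{\|r_0\|} \leq \left(1 - \nu(\mathcal{F}(\widehat{B}))\, \nu(\mathcal{F}(\widehat{B}^{-1}))\right)^{k/2}.$$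
   Context: A singular square matrix $B$ is said to have index 1 if $\mathrm{range}(B) \cap \mathrm{null}(B) = \{0\}$, where $\mathrm{range}(B)$ is the column space and $\mathrm{null}(B)$ the kernel of $B$. $\langle \cdot,\cdot\rangle$ and $\|\cdot\|$ denote the Euclidean inner product and norm. For a square matrix $M$ of size $p$, the field of values is $$\mathcal{F}(M) = \{\langle Mx, x\rangle : x \in \mathbb{C}^p,\ \langle x,x\rangle = 1\} \subset \mathbb{C},$$ and $\nu(\mathcal{F}(M)) = \min_{z \in \mathcal{F}(M)} |z|$ is its distance to the origin. GMRES iterates: for a linear system $My = c$ with starting vector $y_0$ and initial residual $s_0 = c - My_0$, the $k$-th GMRES iterate $y_k$ is the vector in the affine space $y_0 + \mathrm{span}\{s_0, Ms_0, \dots, M^{k-1}s_0\}$ that minimizes $\|c - My\|$ over all $y$ in this affine space. *)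

(* Defs.v *)
From mathcomp Require Import all_boot all_order all_algebra.
From mathcomp Require Import all_classical all_reals all_analysis.
From mathcomp Require Import complex.

Set Implicit Arguments.
Unset Strict Implicit.
Unset Printing Implicit Defensive.

Import Order.TTheory GRing.Theory Num.Theory.

Local Open Scope classical_set_scope.
Local Open Scope ring_scope.
Local Open Scope complex_scope.

(* Vectors are columns and matrices act on the left, unlike in mxalgebra,
   where subspaces are row spaces. *)

Definition range_mx (R : realType) (p q : nat) (A : 'M[R]_(p, q)) :
  set 'cV[R]_p := range (fun w : 'cV[R]_q => A *m w).

Definition null_mx (R : realType) (p q : nat) (A : 'M[R]_(p, q)) :
  set 'cV[R]_q := [set v | A *m v = 0].

Definition singular_index1 (R : realType) (n : nat) (B : 'M[R]_n) : Prop :=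
  B \notin unitmx /\ range_mx B `&` null_mx B = [set 0].

(* The norm `|v| that the libraries put on matrices is the sup norm. *)
Definition enorm (R : realType) (p : nat) (v : 'cV[R]_p) : R :=
  Num.sqrt (\sum_i v i 0 ^+ 2).

Definition cdot (R : realType) (p : nat) (x y : 'cV[R[i]]_p) : R[i] :=
  \sum_i x i 0 * (y i 0)^*.

Definition field_of_values (R : realType) (p : nat) (M : 'M[R[i]]_p) :
  set R[i] := [set cdot (M *m x) x | x in [set x | cdot x x = 1]].

(* For p > 0 the field of values is compact and nonempty, so that the infimum
   is a minimum; for p = 0 it is empty and inf set0 = 0.
   normc is the modulus with values in R (`|z| has values in R[i]). *)
Definition nu (R : realType) (F : set R[i]) : R :=
  inf [set ComplexField.Normc.normc z | z in F].

Definition complexify (R : realType) (p q : nat) (A : 'M[R]_(p, q)) :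
  'M[R[i]]_(p, q) := map_mx (real_complex R) A.

Definition residual (R : realType) (p : nat) (M : 'M[R]_p) (c y : 'cV[R]_p) :
  'cV[R]_p := c - M *m y.

Definition krylov (R : realType) (p : nat) (M : 'M[R]_p) (s : 'cV[R]_p)
  (k : nat) : {vspace 'cV[R]_p} := <<mkseq (fun i => M ^+ i *m s) k>>%VS.

Definition gmres_iterate (R : realType) (p : nat) (M : 'M[R]_p)
  (c y0 : 'cV[R]_p) (k : nat) (y : 'cV[R]_p) : Prop :=
  let K := krylov M (residual M c y0) k in
  y - y0 \in K /\
  forall z, z - y0 \in K -> enorm (residual M c y) <= enorm (residual M c z).

(* Main.v *)
Require Import Defs.
From mathcomp Require Import all_boot all_order all_algebra.
From mathcomp Require Import all_classical all_reals all_analysis.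
From mathcomp Require Import complex.
From mathcomp Require Import ring lra.

Set Implicit Arguments.
Unset Strict Implicit.
Unset Printing Implicit Defensive.

Import Order.TTheory GRing.Theory Num.Theory.

Local Open Scope classical_set_scope.
Local Open Scope ring_scope.

(** The restriction of [B] to its range is, in the orthonormal coordinates given
    by [Pi], the matrix [Bh = Pi^T B Pi]: since [Pi Pi^T] fixes every vector of
    [range B], one has [B Pi = Pi Bh] ([range_mx_intertwine]).  Hence [Pi] carries
    the Krylov spaces of [Bh] onto those of [B] ([krylov_img]), and it preserves
    Euclidean norms.  As [b] lies in [range B] and [x02] in the kernel, the
    substitution [z = x02 + Pi zh] turns the least squares problem defining
    [x k] into the one defining [xh k] ([gmres_iterate_lift]).  Index 1 makes
    [Bh] invertible ([compression_unit]), so that GMRES iterates for [Bh]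
    are unique ([gmres_iterate_uniq]) and both sequences correspond.

    For the convergence bound, one step of GMRES does at least as well as the
    step [y + a r] along the current residual with the best [a], whose residual
    has squared norm
      [|r|^2 - <Mr, r>^2 / |Mr|^2].
    The fields of values of [M] and [M^-1] bound [|<Mr, r>|] below by
    [nu(M) |r|^2] and, with [Mr] as test vector, by [nu(M^-1) |Mr|^2].  The
    product of the two bounds shows that every step multiplies the squared norm
    by at most [1 - nu(M) nu(M^-1)] ([min_residual_step], [gmres_step]). *)

(** * Euclidean inner product *)

Definition edot (R : realType) (p : nat) (u v : 'cV[R]_p) : R :=
  \sum_i u i 0 * v i 0.

Section EuclideanInnerProduct.
Variables (R : realType) (p : nat).
Implicit Types (u v w : 'cV[R]_p) (a : R).

Lemma edotC u v : edot u v = edot v u.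
Proof. by apply: eq_bigr => i _; rewrite mulrC. Qed.

Lemma edotDl u v w : edot (u + v) w = edot u w + edot v w.
Proof. by rewrite -big_split; apply: eq_bigr => i _; rewrite mxE mulrDl. Qed.

Lemma edotZl a u v : edot (a *: u) v = a * edot u v.
Proof. by rewrite /edot mulr_sumr; apply: eq_bigr => i _; rewrite mxE mulrA. Qed.

Lemma edotDr u v w : edot u (v + w) = edot u v + edot u w.
Proof. by rewrite !(edotC u) edotDl. Qed.

Lemma edotZr a u v : edot u (a *: v) = a * edot u v.
Proof. by rewrite !(edotC u) edotZl. Qed.

Lemma edotE u v : edot u v = (u^T *m v) 0 0.
Proof. by rewrite mxE; apply: eq_bigr => i _; rewrite mxE. Qed.

Lemma edot_ge0 v : 0 <= edot v v.
Proof. by apply: sumr_ge0 => i _; rewrite -expr2 sqr_ge0. Qed.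

Lemma edot_eq0 v : (edot v v == 0) = (v == 0).
Proof.
apply/idP/eqP => [|->]; last first.
  by rewrite /edot big1 // => i _; rewrite mxE mul0r.
rewrite psumr_eq0 => [/allP v0|i _]; last by rewrite -expr2 sqr_ge0.
apply/matrixP => i j; rewrite (ord1 j) mxE; apply/eqP.
by have := v0 i (mem_index_enum i); rewrite /= mulf_eq0 orbb.
Qed.

Lemma enormE v : enorm v = Num.sqrt (edot v v).
Proof. by rewrite /enorm; under eq_bigr do rewrite expr2. Qed.

Lemma ler_enorm u v : (enorm u <= enorm v) = (edot u u <= edot v v).
Proof. by rewrite !enormE ler_psqrt // nnegrE edot_ge0. Qed.

End EuclideanInnerProduct.

Lemma edot_isometry (R : realType) (n m : nat) (Q : 'M[R]_(n, m))
    (u v : 'cV[R]_m) :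
  Q^T *m Q = 1%:M -> edot (Q *m u) (Q *m v) = edot u v.
Proof.
by move=> QQ; rewrite !edotE trmx_mul -mulmxA (mulmxA Q^T) QQ mul1mx.
Qed.

(** * Krylov spaces and GMRES iterates *)

Section Krylov.
Variables (R : realType) (p : nat).
Implicit Types (M : 'M[R]_p) (s c y z : 'cV[R]_p).

Lemma expmxS_mul (q : nat) (A : 'M[R]_q) i (v : 'cV[R]_q) :
  A ^+ i.+1 *m v = A *m (A ^+ i *m v).
Proof. by rewrite exprS -mulmxE mulmxA. Qed.

Lemma krylov_img (q : nat) (A : 'M[R]_q) M (Q : 'M[R]_(q, p)) s k :
  A *m Q = Q *m M -> krylov A (Q *m s) k = (linfun (mulmx Q) @: krylov M s k)%VS.
Proof.
move=> AQ; rewrite limg_span -map_comp; congr <<_>>%VS; apply: eq_map => i /=.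
rewrite lfunE /=; elim: i => [|i IH]; first by rewrite !expr0 !mul1mx.
by rewrite !expmxS_mul IH !mulmxA AQ.
Qed.

Lemma mem_krylov M s k i : (i < k)%N -> M ^+ i *m s \in krylov M s k.
Proof.
move=> ik; apply/memv_span/(@mapP nat 'cV[R]_p).
by exists i; rewrite ?mem_iota.
Qed.

Lemma krylov_subP M s k (U : {vspace 'cV[R]_p}) :
  (forall i, (i < k)%N -> M ^+ i *m s \in U) -> (krylov M s k <= U)%VS.
Proof.
move=> sU; apply/span_subvP/allP; rewrite all_map; apply/allP => i.
by rewrite mem_iota add0n; exact: sU.
Qed.

Lemma krylovS M s k : (krylov M s k <= krylov M s k.+1)%VS.
Proof. by apply: krylov_subP => i ik; rewrite mem_krylov // ltnW. Qed.

Lemma krylov_start M s k : s \in krylov M s k.+1.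
Proof. by have := mem_krylov M s (ltn0Sn k); rewrite expr0 mul1mx. Qed.

Lemma krylov_mul M s k v : v \in krylov M s k -> M *m v \in krylov M s k.+1.
Proof.
have /subvP sub : (krylov M s k <= linfun (mulmx M) @^-1: krylov M s k.+1)%VS.
  apply: krylov_subP => i ik.
  by rewrite -memv_preim lfunE /= -expmxS_mul mem_krylov.
by move/sub; rewrite -memv_preim lfunE.
Qed.

Lemma residual_krylov M c y0 k y : y - y0 \in krylov M (residual M c y0) k ->
  residual M c y \in krylov M (residual M c y0) k.+1.
Proof.
move=> yK; have -> : residual M c y = residual M c y0 - M *m (y - y0).
  by rewrite /residual mulmxBr opprB addrA subrK.
by rewrite rpredB ?krylov_start ?krylov_mul.
Qed.

(** Strict convexity of the squared norm: by the parallelogram identity the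
    midpoint of two minimizers would otherwise have a smaller residual.  For
    singular [M] this determines the residual only, not the iterate. *)
Lemma gmres_residual_uniq M c y0 k y z :
  gmres_iterate M c y0 k y -> gmres_iterate M c y0 k z ->
  residual M c y = residual M c z.
Proof.
move=> [yK ymin] [zK zmin]; set K := krylov _ _ _ in yK zK ymin zmin.
pose w := 2^-1 *: (y + z).
have wK : w - y0 \in K.
  have -> : w - y0 = 2^-1 *: ((y - y0) + (z - y0)).
    by apply/matrixP => i j; rewrite !mxE; field.
  by rewrite rpredZ // rpredD.
have := ymin _ wK; have := zmin _ wK; rewrite !ler_enorm.
have -> : residual M c w = 2^-1 *: (residual M c y + residual M c z).
  rewrite /residual /w -scalemxAr mulmxDr.
  by apply/matrixP => i j; rewrite !mxE; field.
move: (residual M c y) (residual M c z) => ry rz hz hy.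
apply/eqP; rewrite -subr_eq0 -edot_eq0 eq_le edot_ge0 andbT.
move: hz hy; rewrite -(scaleN1r rz) !(edotDl, edotDr, edotZl, edotZr).
by rewrite (edotC rz ry); lra.
Qed.

Lemma gmres_iterate_uniq M c y0 k y z : M \in unitmx ->
  gmres_iterate M c y0 k y -> gmres_iterate M c y0 k z -> y = z.
Proof.
move=> Mu gy gz; apply: (can_inj (mulKmx Mu)).
have /addrI/oppr_inj // : c + - (M *m y) = c + - (M *m z).
exact: gmres_residual_uniq gy gz.
Qed.

End Krylov.

(** * Compression to the range *)

Section Compression.
Variables (R : realType) (n m : nat) (B : 'M[R]_n) (Q : 'M[R]_(n, m)).
Hypothesis Q_orth : Q^T *m Q = 1%:M.
Hypothesis Q_range : range_mx Q = range_mx B.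
Let Bh : 'M[R]_m := Q^T *m B *m Q.

Lemma range_mx_proj v : range_mx B v -> Q *m (Q^T *m v) = v.
Proof. by rewrite -Q_range => -[w _ <-]; rewrite (mulmxA Q^T) Q_orth mul1mx. Qed.

(** The columns of [B Q] lie in the range of [B], which [Q Q^T] fixes. *)
Lemma range_mx_intertwine : B *m Q = Q *m Bh.
Proof.
apply/matrixP => i j.
suff /matrixP/(_ i 0) : col j (B *m Q) = col j (Q *m Bh).
  by rewrite ![col _ _ _ _]mxE.
rewrite !colE /Bh -!mulmxA range_mx_proj //.
by exists (Q *m delta_mx j 0).
Qed.

(** If [Bh u = 0] then [B Q u = Q Bh u = 0], so [Q u] lies in both the range and
    the kernel of [B]. *)
Lemma compression_unit : range_mx B `&` null_mx B = [set 0] -> Bh \in unitmx.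
Proof.
move=> index1; rewrite -unitmx_tr -row_free_unit; apply: inj_row_free => u.
move/(congr1 trmx); rewrite trmx_mul trmxK trmx0 => Bu.
have: (range_mx B `&` null_mx B) (Q *m u^T).
  split; first by rewrite -Q_range; exists u^T.
  by rewrite /null_mx /= mulmxA range_mx_intertwine -mulmxA Bu mulmx0.
rewrite index1 => /(congr1 (mulmx Q^T)); rewrite mulmxA Q_orth mul1mx mulmx0.
by move/(congr1 trmx); rewrite trmxK trmx0.
Qed.

Variables (b x1 x2 : 'cV[R]_n).
Hypotheses (b_range : range_mx B b) (x1_range : range_mx B x1).
Hypothesis x2_null : null_mx B x2.

Lemma residual_lift zh :
  residual B b (x2 + Q *m zh) = Q *m residual Bh (Q^T *m b) zh.
Proof.
rewrite /residual mulmxDr x2_null add0r mulmxA range_mx_intertwine.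
by rewrite mulmxBr range_mx_proj // (mulmxA Q Bh).
Qed.

Lemma krylov_lift k zh :
  let xh0 := Q^T *m x1 in
  zh - xh0 \in krylov Bh (residual Bh (Q^T *m b) xh0) k ->
  (x2 + Q *m zh) - (x1 + x2) \in krylov B (residual B b (x1 + x2)) k.
Proof.
move=> xh0 zK; have x0E : x1 + x2 = x2 + Q *m xh0.
  by rewrite range_mx_proj // addrC.
rewrite x0E residual_lift (krylov_img _ _ range_mx_intertwine).
have -> : x2 + Q *m zh - (x2 + Q *m xh0) = linfun (mulmx Q) (zh - xh0).
  by rewrite lfunE /= mulmxBr opprD addrACA subrr add0r.
exact: memv_img.
Qed.

(** Every competitor for the compressed problem lifts to a competitor for the
    full one, and the full iterate is itself such a lift; as the lift preserves
    residual norms, minimality descends. *)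
Lemma gmres_iterate_lift k y : gmres_iterate B b (x1 + x2) k y ->
  exists2 yh, gmres_iterate Bh (Q^T *m b) (Q^T *m x1) k yh
            & y = x2 + Q *m yh.
Proof.
move=> [yK ymin]; set xh0 := Q^T *m x1.
have x0E : x1 + x2 = x2 + Q *m xh0 by rewrite range_mx_proj // addrC.
move: (yK); rewrite x0E residual_lift (krylov_img _ _ range_mx_intertwine).
move=> /memv_imgP[w wK]; rewrite lfunE /= => yE.
have {}yE : y = x2 + Q *m (xh0 + w).
  by rewrite mulmxDr addrA -yE addrC subrK.
exists (xh0 + w) => //; split; first by rewrite addrAC subrr add0r.
move=> zh /krylov_lift/ymin; rewrite yE !residual_lift.
by rewrite !ler_enorm !edot_isometry.
Qed.

End Compression.

(** * Field of values and convergence *)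

Section FieldOfValues.
Variables (R : realType) (p : nat).
Implicit Types (M : 'M[R]_p) (u v : 'cV[R]_p).

Lemma cdot_complexify u v :
  cdot (complexify u) (complexify v) = real_complex R (edot u v).
Proof.
rewrite /cdot /edot rmorph_sum; apply: eq_bigr => i _.
by rewrite !mxE rmorphM /=; congr (_ * _); exact: conjc_real.
Qed.

Lemma normc_ge0 (z : R[i]) : 0 <= ComplexField.Normc.normc z.
Proof. by case: z => a b; exact: sqrtr_ge0. Qed.

Lemma nu_ge0 (F : set R[i]) : 0 <= nu F.
Proof.
rewrite /nu; set E := (X in inf X); have [->|E0] := eqVneq E set0.
  by rewrite inf0.
by apply: lb_le_inf => [|_ [z _ <-]]; [exact/set0P | exact: normc_ge0].
Qed.

(** Real vectors are particular test vectors for the complex field of values. *)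
Lemma nu_edot M v :
  nu (field_of_values (complexify M)) * edot v v <= `|edot (M *m v) v|.
Proof.
have [->|v0] := eqVneq v 0.
  by rewrite (eqP (_ : edot 0 0 == 0)) ?edot_eq0 // mulr0 normr_ge0.
have vv : 0 < edot v v by rewrite lt_def edot_eq0 v0 edot_ge0.
pose a := (Num.sqrt (edot v v))^-1.
have aa : a * a = (edot v v)^-1.
  by rewrite /a -invfM -expr2 sqr_sqrtr // edot_ge0.
rewrite -ler_pdivlMr // -[(edot v v)^-1]gtr0_norm ?invr_gt0 // -normrM.
apply: ge_inf; first by exists 0 => _ [z _ <-]; exact: normc_ge0.
exists (real_complex R (edot (M *m v) v / edot v v)); last first.
  by rewrite /= expr0n addr0 sqrtr_sqr.
exists (complexify (a *: v)).
  by rewrite /= cdot_complexify edotZl edotZr mulrA aa mulVf ?gt_eqF.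
rewrite /complexify -map_mxM cdot_complexify -scalemxAr edotZl edotZr.
by rewrite mulrA aa mulrC.
Qed.

(** The best step along [M v] subtracts [<M v, v>^2 / |M v|^2] from the squared
    norm.  Bounding one factor [<M v, v>] through [M] tested on [v], the other
    through [M^-1] tested on [M v], makes [|M v|^2] cancel. *)
Lemma min_residual_step M v : M \in unitmx ->
  exists a, edot (v - a *: (M *m v)) (v - a *: (M *m v)) <=
    (1 - nu (field_of_values (complexify M)) *
         nu (field_of_values (complexify (invmx M)))) * edot v v.
Proof.
move=> Mu; set d := nu _; set e := nu _; set s := M *m v.
have := nu_edot M v; have := nu_edot (invmx M) s; rewrite -/d -/e -/s.
rewrite {1 2}/s mulKmx // -/s (edotC v s) => es dv.
have [s0|s0] := eqVneq s 0.
  exists 0; have -> : v = 0 by rewrite -(mulKmx Mu v) -/s s0 mulmx0.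
  by rewrite s0 scaler0 subr0 (eqP (_ : edot 0 0 == 0)) ?edot_eq0 // mulr0.
have ss : 0 < edot s s by rewrite lt_def edot_eq0 s0 edot_ge0.
exists (edot s v / edot s s).
rewrite -scaleNr !(edotDl, edotDr, edotZl, edotZr) (edotC v s).
have := ler_pM (mulr_ge0 (nu_ge0 _) (edot_ge0 v))
               (mulr_ge0 (nu_ge0 _) (edot_ge0 s)) dv es.
rewrite -normrM ger0_norm -?expr2 ?sqr_ge0 // => de.
(* Multiplying by [|s|^2] clears the denominator of the step length. *)
rewrite -subr_ge0 -(pmulr_rge0 _ ss).
set lhs := (X in 0 <= X).
suff -> : lhs = edot s v ^+ 2 - d * edot v v * (e * edot s s) by rewrite subr_ge0.
by rewrite /lhs; field; rewrite gt_eqF.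
Qed.

(** The residual after [k] steps lies in the Krylov space of order [k + 1], so a
    minimal residual step from the iterate [y] is a competitor of the next iterate. *)
Lemma gmres_step M c y0 k y z : M \in unitmx ->
  gmres_iterate M c y0 k y -> gmres_iterate M c y0 k.+1 z ->
  edot (residual M c z) (residual M c z) <=
    (1 - nu (field_of_values (complexify M)) *
         nu (field_of_values (complexify (invmx M)))) *
    edot (residual M c y) (residual M c y).
Proof.
move=> Mu [yK _] [_ zmin].
have step v a : residual M c y - a *: (M *m v) = residual M c (y + a *: v).
  by rewrite /residual mulmxDr -scalemxAr opprD addrA.
have [a] := min_residual_step (residual M c y) Mu; apply: le_trans; rewrite step.
rewrite -ler_enorm; apply: zmin; rewrite addrAC rpredD //.
  by apply: subvP yK; exact: krylovS.
by rewrite rpredZ // residual_krylov.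
Qed.

Lemma gmres_bound M c y0 (y : nat -> 'cV[R]_p) k : M \in unitmx ->
  (forall j, gmres_iterate M c y0 j (y j)) -> residual M c (y 0%N) != 0 ->
  enorm (residual M c (y k)) / enorm (residual M c (y 0%N)) <=
    (1 - nu (field_of_values (complexify M)) *
         nu (field_of_values (complexify (invmx M)))) `^ (k%:R / 2).
Proof.
move=> Mu yP r0; set q := 1 - _.
have rr0 : 0 < edot (residual M c (y 0%N)) (residual M c (y 0%N)).
  by rewrite lt_def edot_eq0 r0 edot_ge0.
(* The rate is nonnegative because a squared norm lies below [q |r_0|^2]. *)
have q0 : 0 <= q.
  rewrite -(pmulr_lge0 _ rr0); apply: le_trans (gmres_step Mu (yP 0%N) (yP 1%N)).
  exact: edot_ge0.
have decay j : edot (residual M c (y j)) (residual M c (y j)) <=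
    q ^+ j * edot (residual M c (y 0%N)) (residual M c (y 0%N)).
  elim: j => [|j IH]; first by rewrite mul1r.
  apply: le_trans (gmres_step Mu (yP j) (yP j.+1)) _.
  by rewrite exprS -mulrA ler_wpM2l.
rewrite powRrM powR_mulrn // powR12_sqrt ?exprn_ge0 //.
rewrite !enormE ler_pdivrMr ?sqrtr_gt0 // -sqrtrM ?exprn_ge0 //.
exact/ler_wsqrtr/decay.
Qed.

End FieldOfValues.

Theorem theorem3 (R : realType) (n m : nat) (B : 'M[R]_n)
    (hB : singular_index1 B) (hm : m = \rank B) (hmn : (m < n)%N)
    (Pi : 'M[R]_(n, m)) (hPi_orth : Pi^T *m Pi = 1%:M)
    (hPi_span : range_mx Pi = range_mx B)
    (b : 'cV[R]_n) (hb : range_mx B b)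
    (x0 x01 x02 : 'cV[R]_n) (hx0 : x0 = x01 + x02)
    (hx01 : range_mx B x01) (hx02 : null_mx B x02)
    (x : nat -> 'cV[R]_n) (hx : forall k, gmres_iterate B b x0 k (x k)) :
  let Bh : 'M[R]_m := Pi^T *m B *m Pi in
  let bh : 'cV[R]_m := Pi^T *m b in
  let r : nat -> 'cV[R]_n := fun k => residual B b (x k) in
  forall xh : nat -> 'cV[R]_m,
  (forall k, gmres_iterate Bh bh (Pi^T *m x01) k (xh k)) ->
  let rh : nat -> 'cV[R]_m := fun k => residual Bh bh (xh k) in
  (forall k, x k = x02 + Pi *m xh k /\ r k = Pi *m rh k) /\
  (0 < nu (field_of_values (complexify Bh)) -> r 0%N != 0 ->
   forall k, enorm (r k) / enorm (r 0%N) <=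
     (1 - nu (field_of_values (complexify Bh)) *
          nu (field_of_values (complexify (invmx Bh)))) `^ (k%:R / 2)).
Proof.
move=> Bh bh r xh xhP rh; case: hB => _ index1.
have Bu : Bh \in unitmx by exact: compression_unit.
have xE k : x k = x02 + Pi *m xh k.
  have := hx k; rewrite hx0 => xk.
  have [yh yhP ->] := gmres_iterate_lift hPi_orth hPi_span hb hx01 hx02 xk.
  by rewrite (gmres_iterate_uniq Bu yhP (xhP k)).
have rE k : r k = Pi *m rh k.
  by rewrite /r xE (residual_lift hPi_orth hPi_span hb hx02).
split=> [k|_ r0 k]; first by split.
have norm_r j : enorm (r j) = enorm (rh j).
  by rewrite rE !enormE edot_isometry.
rewrite !norm_r; apply: gmres_bound Bu xhP _.
by apply: contraNneq r0 => rh0; rewrite rE /rh rh0 mulmx0.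
Qed.
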